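(* Let $A$ be any $d\times n$ tropical matrix, let $\mathcal{H}=\mathcal{H}(A)$ be the corresponding arrangement of tropical hyperplanes, and let $L$ be the lattice ideal of the associated root polytope $Q_{B_A}$. Then the fine cotype ideal $I_{\overline{T}(\mathcal{H})}$ associated to $\mathcal{H}$ is the Alexander dual of $M(\mathrm{in}_A(L))$, where $M(\mathrm{in}_A(L))$ is the largest monomial ideal contained in $\mathrm{in}_A(L)$.
   Context: A $d\times n$ tropical matrix is a matrix $A=(a_{ik})$ with entries in $\mathbb{R}\cup\{\infty\}$ such that every column has at least one finite entry; $\mathrm{supp}(A)=\{(i,k):a_{ik}\text{ finite}\}$ and $B_A\subseteq K_{d,n}$ is the bipartite graph on $[d]\sqcup[n]$ with edge set $\mathrm{supp}(A)$. The arrangement $\mathcal{H}(A)$ consists of the max-tropical hyperplanes whose apices are the columns $\mathbf{a}_k$ of $A$. Let $\mathbb{1}\in\mathbb{R}^d$ be the all-ones vector. The $i$-th closed sector of the $k$-th hyperplane is $S_i(\mathbf{a}_k)=\{\mathbf{p}\in\mathbb{R}^d/\mathbb{R}\mathbb{1}: p_i-a_{ik}\ge p_j-a_{jk}\ \forall j\in[d]\}$ (with $p_j-\infty=-\infty$). The fine type of $\mathbf{p}\in\mathbb{R}^d/\mathbb{R}\mathbb{1}$ is $T(\mathbf{p})\in\{0,1\}^{d\times n}$ with $T(\mathbf{p})_{ik}=1$ iff $(i,k)\in\mathrm{supp}(A)$ and $\mathbf{p}\in S_i(\mathbf{a}_k)$; the fine cotype is $\overline{T}(\mathbf{p})_{ik}=1-T(\mathbf{p})_{ik}$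 for $(i,k)\in\mathrm{supp}(A)$ and $0$ otherwise. Let $\Bbbk$ be a field and $\widetilde{S}=\Bbbk[x_{ij}:(i,j)\in\mathrm{supp}(A)]$. The fine cotype ideal is $I_{\overline{T}(\mathcal{H})}=\langle\prod_{\overline{T}(\mathbf{p})_{ij}=1}x_{ij} : \mathbf{p}\in\mathbb{R}^d/\mathbb{R}\mathbb{1}\rangle\subseteq\widetilde{S}$. The root polytope of $B_A$ is $Q_{B_A}=\mathrm{conv}\{\mathbf{e}_i-\mathbf{e}_{\bar j}:(i,j)\in E(B_A)\}\subset\mathbb{R}^{d+n}$. Its lattice ideal $L\subseteq\widetilde{S}$ is the kernel of the $\Bbbk$-algebra map $\widetilde{S}\to\Bbbk[x_1,\dots,x_d,y_1^{-1},\dots,y_n^{-1}]$, $x_{ij}\mapsto x_iy_j^{-1}$. Give the variable $x_{ij}$ weight $a_{ij}$. For $f\in\widetilde{S}$, $\mathrm{in}_A(f)$ is the sum of the terms of $f$ of maximal weight, and $\mathrm{in}_A(L)=\langle\mathrm{in}_A(f):f\in L\rangle$ (not necessarily a monomial ideal). The Alexander dual of a squarefree monomial ideal $\langle \mathbf{x}^{\sigma_1},\dots,\mathbf{x}^{\sigma_r}\rangle$ is $\bigcap_{l=1}^r\langle x_{ij}:(i,j)\in\sigma_l\rangle$ (the assertion includes that $M(\mathrm{in}_A(L))$ is squarefree). *)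

(* Defs.v *)
From HB Require Import structures.
From mathcomp Require Import all_boot all_order all_algebra.
From mathcomp Require Import mpoly.
From mathcomp Require Import boolp classical_sets reals constructive_ereal.

Set Implicit Arguments.
Unset Strict Implicit.
Unset Printing Implicit Defensive.

Import Order.TTheory GRing.Theory Num.Theory.
Local Open Scope classical_set_scope.
Local Open Scope ring_scope.

Section Ideals.
Variable S : comNzRingType.

(* MathComp's [idealr_closed] is for boolean predicates and excludes the unit
   ideal, which does occur here. *)
Definition is_ideal (I : set S) : Prop :=
  [/\ I 0, forall f g, I f -> I g -> I (f + g) & forall f g, I g -> I (f * g)].

Definition ideal_gen (G : set S) : set S := smallest is_ideal G.

End Ideals.

Section MonomialIdeals.
Variables (K : fieldType) (N : nat).

Definition is_monomial_ideal (J : set {mpoly K[N]}) : Prop :=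
  exists G : set 'X_{1..N}, J = ideal_gen [set 'X_[m] | m in G].

Definition is_largest_monomial_subideal (J M : set {mpoly K[N]}) : Prop :=
  [/\ is_monomial_ideal M, M `<=` J &
      forall M', is_monomial_ideal M' -> M' `<=` J -> M' `<=` M].

Definition squarefree_ideal (s : seq {set 'I_N}) : set {mpoly K[N]} :=
  ideal_gen [set \prod_(v in sigma) 'X_v | sigma in [set` s]].

(* In the empty case [s = [::]] this is the whole ring. *)
Definition prime_intersection (s : seq {set 'I_N}) : set {mpoly K[N]} :=
  \bigcap_(sigma in [set` s]) ideal_gen [set 'X_v | v in [set` sigma]].

(* [J] is a squarefree monomial ideal and [I] is its Alexander dual, computed
   from any squarefree generating family of [J]. *)
Definition is_alexander_dual (J I : set {mpoly K[N]}) : Prop :=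
  (exists s : seq {set 'I_N}, J = squarefree_ideal s) /\
  (forall s : seq {set 'I_N}, J = squarefree_ideal s ->
     I = prime_intersection s).

End MonomialIdeals.

Section TropicalArrangement.
Variables (R : realType) (d n : nat).
Implicit Types (A : 'M[\bar R]_(d, n)) (p : 'cV[R]_d).

(* The tropical zero is [+oo]; [\bar R] also contains [-oo], which is not an
   allowed entry. *)
Definition tropical_matrix A : Prop :=
  (forall i k, A i k != -oo%E) /\ (forall k, exists i, A i k \is a fin_num).

(* The edge set of the bipartite graph of [A] on [d] + [n]. *)
Definition supp A : {set 'I_d * 'I_n} :=
  [set ik : 'I_d * 'I_n | A ik.1 ik.2 \is a fin_num]%SET.

(* A point of R^d / R1 is given by a representative in R^d, see
   [fine_type_shift].  In [\bar R] one has x - +oo = -oo for x real. *)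
Definition sector A (i : 'I_d) (k : 'I_n) : set 'cV[R]_d :=
  [set p : 'cV[R]_d |
    forall j, ((p i ord0)%:E - A i k >= (p j ord0)%:E - A j k)%E].

Definition fine_type A p : 'M[bool]_(d, n) :=
  \matrix_(i, k) (((i, k) \in supp A) && (p \in sector A i k)).

Definition fine_cotype A p : 'M[bool]_(d, n) :=
  \matrix_(i, k) (((i, k) \in supp A) && ~~ fine_type A p i k).

Lemma fine_type_shift A p (c : R) :
  fine_type A (p + const_mx c) = fine_type A p.
Proof.
have sh i k : (((p + const_mx c)%R i ord0)%:E - A i k =
              (p i ord0)%:E - A i k + c%:E)%E.
  by rewrite !mxE EFinD addeAC.
apply/matrixP => i k; rewrite !mxE; congr andb.
apply/idP/idP; rewrite !inE => Hp j; have := Hp j; rewrite !sh.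
- by rewrite leeD2rE.
- by move=> le_ji; exact: leeD2r.
Qed.

Definition edge A : finType := {ik : 'I_d * 'I_n | ik \in supp A}.

(* Number of variables of k[x_ij : (i,j) in supp A]; the variable numbered [v]
   is x_ij with (i,j) = [edge_of v]. *)
Definition nvars A : nat := #|edge A|.

Definition edge_of A (v : 'I_(nvars A)) : 'I_d * 'I_n := val (enum_val v).

Section CoefficientField.
Variables (K : fieldType) (A : 'M[\bar R]_(d, n)).
Local Notation St := {mpoly K[nvars A]}.

Definition cotype_monomial p : St :=
  \prod_(v | fine_cotype A p (edge_of v).1 (edge_of v).2) 'X_v.

Definition cotype_ideal : set St := ideal_gen (range cotype_monomial).

(* k[x_1, .., x_d, y_1^-1, .., y_n^-1] is the polynomial ring in the d + n
   algebraically independent elements x_i and y_j^-1. *)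
Definition x_ (i : 'I_d) : {mpoly K[d + n]} := 'X_(lshift n i).
Definition yinv_ (j : 'I_n) : {mpoly K[d + n]} := 'X_(rshift d j).

Definition toric_map : St -> {mpoly K[d + n]} :=
  mmap (@mpolyC (d + n) K) (fun v => x_ (edge_of v).1 * yinv_ (edge_of v).2).

Definition lattice_ideal : set St := [set f | toric_map f = 0].

Definition weight (m : 'X_{1..nvars A}) : R :=
  \sum_(v < nvars A) fine (A (edge_of v).1 (edge_of v).2) *+ m v.

Definition initial_form (f : St) : St :=
  \sum_(m <- msupp f | all (fun m' => weight m' <= weight m) (msupp f))
     f@_m *: 'X_[m].

Definition initial_ideal (J : set St) : set St :=
  ideal_gen [set initial_form f | f in J].

End CoefficientField.
End TropicalArrangement.

Arguments cotype_ideal {R d n} K A.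
Arguments lattice_ideal {R d n} K A.
Arguments initial_ideal {R d n K} A J.

(* Main.v *)
Require Import Defs.
From HB Require Import structures.
From mathcomp Require Import all_boot all_order all_algebra.
From mathcomp Require Import mpoly.
From mathcomp Require Import boolp classical_sets reals constructive_ereal.

Set Implicit Arguments.
Unset Strict Implicit.
Unset Printing Implicit Defensive.

Import Order.TTheory GRing.Theory Num.Theory.
Local Open Scope classical_set_scope.
Local Open Scope ring_scope.

(** Call the set of edges recorded by the fine type of a point [p] a face.  The
    whole theorem follows from a description of the monomials of the initial
    ideal: ['X_[m]] lies in [in_A(L)] exactly when the support of [m] is
    contained in no face.  The monomials with that property span the largest
    monomial subideal; being determined by supports it is squarefree, and its
    Alexander dual is generated by the products over the complements of the
    faces, which are the cotype monomials ([face_ideal_alexander_dual]).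

    A monomial supported on the face of [p] is not in [in_A(L)]
    ([initial_ideal_face]).  With q_k = max_j (p_j - a_jk), the numbers
    g_ik = q_k - (p_i - a_ik) are nonnegative and vanish exactly on the face,
    while g and a differ on monomials by a function of the toric degree only.
    So on each toric degree the monomials supported on the face are the
    monomials of least weight, and the ring map which kills the variables
    outside the face and is the toric map on the others annihilates every
    initial form of [L]: if a term of maximal weight survives, then all terms
    of its degree have the same weight, and their images cancel since [f] is in
    the kernel of the toric map.  This ring map does not annihilate the given
    monomial.

    Conversely, let the support tau of [m] be contained in no face
    ([non_face_initial_ideal]).  A point whose face contains tau is the same as
    a solution of the inequalities p_j - a_jk <= q_k <= p_i - a_ik for edges
    (j,k), and (i,k) in tau.  These are difference constraints on the vertices
    of the bipartite graph, so their infeasibility yields a simple directed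
    cycle of negative cost ([potential_exists]).  Let u be the product of the
    edges that the cycle traverses from columns to rows, all of them in tau, and
    v the product of those it traverses from rows to columns.  The cycle enters
    and leaves every vertex once, so u and v have the same toric degree, and
    negative cost says that u has the larger weight: hence u is the initial form
    of u - v.  Since the cycle is simple, u is
    squarefree and so divides ['X_[m]]. *)

(** * Monomial ideals *)

Section Ideals.
Variable S : comNzRingType.
Implicit Types G I : set S.

Lemma ideal_gen_ideal G : is_ideal (ideal_gen G).
Proof.
split=> [I [[]] //|f g If Ig I idI|f g Ig I idI].
- by case: (idI) => -[_ addI _] _; apply: addI; [apply: If|apply: Ig].
- by case: (idI) => -[_ _ mulI] _; apply: mulI; apply: Ig.
Qed.

Lemma ideal_gen_sub G : G `<=` ideal_gen G.
Proof. exact: sub_gen_smallest. Qed.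

Lemma ideal_gen_min G I : is_ideal I -> G `<=` I -> ideal_gen G `<=` I.
Proof. exact: smallest_sub. Qed.

Lemma ideal_gen_mono G G' : G `<=` G' -> ideal_gen G `<=` ideal_gen G'.
Proof.
move=> GG'; apply: ideal_gen_min; first exact: ideal_gen_ideal.
by move=> f /GG'; exact: ideal_gen_sub.
Qed.

End Ideals.

Section MonomialIdeals.
Variables (K : fieldType) (N : nat).
Implicit Types (m : 'X_{1..N}) (s : seq {set 'I_N}).

Definition mnm_support m : {set 'I_N} := [set v | m v != 0%N]%SET.

Lemma mesym1_le_support (sigma : {set 'I_N}) m :
  (mesym1 sigma <= m)%MM = (sigma \subset mnm_support m)%SET.
Proof.
apply/mnm_lepP/fintype.subsetP => [le_m v v_s | sub v].
  by have := le_m v; rewrite mnmE v_s inE lt0n.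
by rewrite mnmE; case: (boolP (v \in sigma)) => // /sub; rewrite inE lt0n.
Qed.

Lemma supp_mesym1 (sigma : {set 'I_N}) : mnm_support (mesym1 sigma) = sigma.
Proof. by apply/setP => v; rewrite inE mnmE; case: (v \in sigma). Qed.

Lemma ideal_mulX (I : set {mpoly K[N]}) m m' :
  is_ideal I -> I 'X_[m'] -> (m' <= m)%MM -> I 'X_[m].
Proof.
by move=> [_ _ mulI] Im' le_m; rewrite -(submK le_m) mpolyXD; exact: mulI.
Qed.

(** The polynomials whose terms are all divisible by some generator form an
    ideal, because a term of a product is a product of terms. *)
Lemma monomial_idealP T (F : T -> 'X_{1..N}) (D : set T) (f : {mpoly K[N]}) :
  ideal_gen [set 'X_[F i] | i in D] f <->
  forall m, m \in msupp f -> exists2 i, D i & (F i <= m)%MM.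
Proof.
split=> [|suppf]; last first.
  have [ideal0 idealD idealM] := ideal_gen_ideal [set 'X_[K, F i] | i in D].
  rewrite (mpolyE f) big_seq; elim/big_ind: _ => // m /suppf[i Di le_im].
  rewrite -mul_mpolyC; apply: idealM.
  apply: ideal_mulX le_im; first exact: ideal_gen_ideal.
  by apply: ideal_gen_sub; exists i.
move: f; apply: ideal_gen_min => [|_ [i Di <-] m]; last first.
  by rewrite msuppX inE => /eqP->; exists i => //; exact: lepm_refl.
split=> [m|f g If Ig m /msuppD_le|f g Ig m /msuppM_le].
- by rewrite msupp0.
- by rewrite mem_cat => /orP[/If|/Ig].
- move=> /allpairsP[[m1 m2] /= [_ /Ig[i Di le_im] ->]].
  by exists i => //; apply: lepm_trans le_im _; exact: lem_addl.
Qed.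

Lemma squarefree_idealP T (F : T -> {set 'I_N}) (D : set T) (f : {mpoly K[N]}) :
  ideal_gen [set \prod_(v in F i) 'X_v | i in D] f <->
  forall m, m \in msupp f ->
    exists2 i, D i & (F i \subset mnm_support m)%SET.
Proof.
have <- : [set 'X_[K, mesym1 (F i)] | i in D] =
          [set \prod_(v in F i) 'X_v | i in D].
  apply: eq_imagel => i _; rewrite mpolyXE_id [RHS]big_mkcond.
  apply: eq_bigr => v _; rewrite mnmE.
  by case: (v \in F i); rewrite ?expr1 ?expr0.
rewrite monomial_idealP.
by split=> suppf m /suppf[i Di]; rewrite ?mesym1_le_support => ?; exists i;
  rewrite ?mesym1_le_support.
Qed.

Lemma prime_intersectionP s (f : {mpoly K[N]}) :
  prime_intersection s f <->
  forall m sigma, m \in msupp f -> sigma \in s ->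
    exists2 v, v \in sigma & v \in mnm_support m.
Proof.
have le_U v m : (U_(v) <= m)%MM = (v \in mnm_support m).
  by rewrite lep1mP inE.
split=> [If m sigma mf sigma_s | suppf sigma sigma_s].
  have /monomial_idealP/(_ m mf)[v] := If sigma sigma_s.
  by rewrite le_U; exists v.
apply/monomial_idealP => m mf.
by have [v v_s v_m] := suppf m sigma mf sigma_s; exists v; rewrite ?le_U.
Qed.

(** Alexander duality for the complex with facets among the [F t].  A set
    [B] contains the complement of some [F t] iff the complement of [B] lies in
    some [F t], i.e. is a face, i.e. contains no generator of the non-face
    ideal, i.e. [B] meets all these generators; the last condition describes
    the monomials of the intersection of primes, for any choice of squarefree
    generators. *)
Lemma face_ideal_alexander_dual T (F : T -> {set 'I_N}) :
  is_alexander_dual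
    (ideal_gen [set 'X_[K, m] | m in
       [set m | forall t, ~~ (mnm_support m \subset F t)%SET]])
    (ideal_gen (range (fun t => \prod_(v in (~: F t)%SET) 'X_v))).
Proof.
set M := ideal_gen _.
have MX (sigma : {set 'I_N}) :
    M 'X_[mesym1 sigma] <-> forall t, ~~ (sigma \subset F t)%SET.
  split=> [/monomial_idealP/(_ (mesym1 sigma)) | nF].
    rewrite msuppX inE => /(_ (eqxx _))[m /= nF /mnm_lepP le_m] t.
    apply: (contra _ (nF t)) => sub_sigma.
    apply: (fintype.subset_trans _ sub_sigma); apply/fintype.subsetP => v mv.
    by rewrite -(supp_mesym1 sigma) inE -lt0n (leq_trans _ (le_m v)) // lt0n;
      rewrite inE in mv.
  by apply: ideal_gen_sub; exists (mesym1 sigma) => //= t; rewrite supp_mesym1.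
split=> [|s Ms].
  exists [seq sigma <- enum {set 'I_N} | `[< M 'X_[mesym1 sigma] >]].
  apply/seteqP; split=> f.
    move=> /monomial_idealP Mf; apply/squarefree_idealP => m /Mf[m' nF le_m].
    exists (mnm_support m').
      rewrite /= mem_filter mem_enum andbT; apply/asboolP/MX => t; exact: nF.
    apply/fintype.subsetP => v; rewrite !inE -!lt0n => /leq_trans; apply.
    exact/mnm_lepP.
  move=> /squarefree_idealP Mf; apply/monomial_idealP => m /Mf[sigma].
  rewrite /= mem_filter => /andP[/asboolP/MX nF _] sub_m.
  exists m; last exact: lepm_refl.
  by move=> t; apply: (contra _ (nF t)); apply: fintype.subset_trans.
have MsX (sigma : {set 'I_N}) :
    M 'X_[mesym1 sigma] <-> exists2 tau, tau \in s & (tau \subset sigma)%SET.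
  rewrite Ms; split=> [/squarefree_idealP/(_ (mesym1 sigma))|[tau tau_s sub]].
    rewrite msuppX inE supp_mesym1 => /(_ (eqxx _))[tau tau_s sub].
    by exists tau.
  apply/squarefree_idealP => m; rewrite msuppX inE => /eqP->.
  by exists tau => //; rewrite supp_mesym1.
(* The pointwise form of the duality, for the support B of a single term. *)
have hit (B : {set 'I_N}) : (exists t, (~: F t \subset B)%SET) <->
    forall sigma, sigma \in s -> exists2 v, v \in sigma & v \in B.
  have -> : (exists t, (~: F t \subset B)%SET) <-> ~ M 'X_[mesym1 (~: B)%SET].
    rewrite MX; split=> [[t sub] /(_ t)|/existsNP[t]].
      by rewrite finset.subCset sub.
    by move=> /negP; rewrite negbK => sub; exists t; rewrite finset.subCset.
  rewrite MsX; split=> [nsub sigma sigma_s | hit [sigma /hit[v v_s v_B]]].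
    apply: contrapT => nex; apply: nsub; exists sigma => //.
    apply/fintype.subsetP => v v_s; rewrite inE; apply/negP => v_B.
    by apply: nex; exists v.
  by move=> /fintype.subsetP/(_ v v_s); rewrite inE v_B.
apply/seteqP; split=> f.
  move=> /squarefree_idealP If; apply/prime_intersectionP => m sigma mf sigma_s.
  have [t _ sub] := If m mf.
  by apply: (proj1 (hit (mnm_support m))) sigma_s; exists t.
move=> /prime_intersectionP If; apply/squarefree_idealP => m mf.
have /hit[t sub] : forall sigma, sigma \in s ->
    exists2 v, v \in sigma & v \in mnm_support m by move=> sigma; exact: If.
by exists t.
Qed.
End MonomialIdeals.

(** * Shortest walks and potentials *)

(** [zip] drops the last vertex of [x :: s] as a source. *)
Definition arcs (T : Type) (x : T) (s : seq T) : seq (T * T) := zip (x :: s) s.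

Section Potential.
Variables (T : finType) (R : realDomainType) (e : rel T) (c : T * T -> R).

Definition walk_cost (x : T) (s : seq T) : R := \sum_(a <- arcs x s) c a.

Lemma walk_cost_cons x y s :
  walk_cost x (y :: s) = c (x, y) + walk_cost y s.
Proof. by rewrite /walk_cost /arcs /= big_cons. Qed.

Lemma walk_cost_cat x y s1 s2 :
  walk_cost x (s1 ++ y :: s2) = walk_cost x (rcons s1 y) + walk_cost y s2.
Proof.
elim: s1 x => [|z s1 IHs] x /=; last by rewrite !walk_cost_cons IHs addrA.
by rewrite !walk_cost_cons /walk_cost /arcs /= big_nil addr0.
Qed.

(** Only simple cycles are constrained: this is what later makes the monomial
    read off from a negative cycle squarefree. *)
Definition no_negative_cycle :=
  forall x s, uniq (x :: s) -> path e x (rcons s x) ->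
    0 <= walk_cost x (rcons s x).

(** The potential at [x] is the least cost of a simple walk starting at [x];
    there are finitely many of them, as they have at most #|T| arcs.  If
    prefixing an optimal walk from [y] with the arc from [x] to [y] gives a walk
    that revisits [x], then cutting off the resulting cycle, of nonnegative
    cost, leaves a simple walk from [x] that is no more expensive. *)
Lemma potential_exists : no_negative_cycle ->
  exists p : T -> R, forall x y, e x y -> p x <= c (x, y) + p y.
Proof.
move=> ge0_cycle.
pose walk x (s : #|T|.-bseq T) := uniq (x :: s) && path e x s.
pose best x := [arg min_(s < [bseq] | walk x s) walk_cost x s]%O.
have bestP x : walk x (best x) /\
    forall s, uniq (x :: s) -> path e x s ->
      walk_cost x (best x) <= walk_cost x s.
  rewrite /best; case: arg_minP => //= s ws min_s; split=> // s'.
  rewrite -cons_uniq => us' es'.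
  have sz : (size s' <= #|T|)%N.
    by have := max_card (mem (x :: s')); rewrite (card_uniqP us'); apply: ltnW.
  by apply: (min_s (Bseq sz)); rewrite /walk us' es'.
exists (fun x => walk_cost x (best x)) => x y xy.
have [/andP[uy ey] _] := bestP y; have [_ min_x] := bestP x.
have exy : path e x (y :: best y) by rewrite /= xy.
rewrite -walk_cost_cons; have [|x_y] := boolP (x \in y :: best y); last first.
  by apply: min_x => //; rewrite cons_uniq x_y.
move: (y :: best y : seq T) uy exy => r uy exy x_r.
case/splitPr: x_r uy exy => s1 s2 uy exy.
have [e1 e2] : path e x (rcons s1 x) /\ path e x s2.
  by move: exy; rewrite cat_path rcons_path /= => /and3P[-> -> ->].
have [u1 u2] : uniq (x :: s1) /\ uniq (x :: s2).
  move: uy; rewrite cat_uniq /= => /and3P[us1 + /andP[-> ->]].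
  by rewrite us1 andbT negb_or => /andP[].
rewrite walk_cost_cat; apply: le_trans (min_x s2 u2 e2) _.
by rewrite lerDr ge0_cycle.
Qed.
End Potential.

(** * The toric degree *)

(** The weight of a monomial is the instance where [g] lists the matrix
    entries; other choices of [g] give weights that are compared with it. *)
Definition mnm_eval (R : zmodType) N (g : 'I_N -> R) (m : 'X_{1..N}) : R :=
  \sum_i g i *+ m i.

Lemma mnm_evalD (R : zmodType) N (g : 'I_N -> R) m1 m2 :
  mnm_eval g (m1 + m2)%MM = mnm_eval g m1 + mnm_eval g m2.
Proof.
rewrite /mnm_eval -big_split; apply: eq_bigr => i _.
by rewrite mnmDE mulrnDr.
Qed.

Lemma mnm_evalU (R : zmodType) N (g : 'I_N -> R) i : mnm_eval g U_(i) = g i.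
Proof.
rewrite /mnm_eval (bigD1 i) //= big1 => [|j ji]; rewrite mnm1E.
  by rewrite eqxx addr0.
by rewrite eq_sym (negbTE ji).
Qed.

Section Toric.
Variables (R : realType) (K : fieldType) (d n : nat) (A : 'M[\bar R]_(d, n)).
Local Notation N := (nvars A).
Implicit Types (m : 'X_{1..N}) (v : 'I_N) (p : 'cV[R]_d).

Local Notation row v := (edge_of v).1.
Local Notation col v := (edge_of v).2.
Local Notation edge_deg v := (U_(lshift n (row v)) + U_(rshift d (col v)))%MM.

Definition cost v : R := fine (A (row v) (col v)).

Lemma edge_of_inj : injective (@edge_of R d n A).
Proof. by move=> v w /val_inj; exact: enum_val_inj. Qed.

Lemma edge_of_fin_num v : A (row v) (col v) \is a fin_num.
Proof. by have := valP (enum_val v); rewrite inE. Qed.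

Lemma edge_of_surj i k : A i k \is a fin_num ->
  exists v, edge_of v = (i, k) :> 'I_d * 'I_n.
Proof.
move=> Aik; have ik_supp : (i, k) \in supp A by rewrite inE.
by exists (enum_rank (exist _ (i, k) ik_supp : edge A));
  rewrite /edge_of enum_rankK.
Qed.

Lemma costE v : A (row v) (col v) = (cost v)%:E.
Proof. by rewrite fineK ?edge_of_fin_num. Qed.

Definition toric_deg m : 'X_{1..d + n} := (\sum_v edge_deg v *+ m v)%MM.

(** A vertex function pulls back, along the toric degree, to the edge function
    adding its values at the two ends. *)
Lemma toric_deg_eval (alpha : 'I_(d + n) -> R) m :
  mnm_eval alpha (toric_deg m) =
  \sum_v (alpha (lshift n (row v)) + alpha (rshift d (col v))) *+ m v.
Proof.
rewrite /toric_deg; elim/big_rec2: _ => [|v s t _ <-].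
  by rewrite /mnm_eval big1 // => i _; rewrite mnm0E.
rewrite mnm_evalD; congr (_ + _); elim: (m v) => [|k IHk].
  by rewrite mulm0n /mnm_eval big1 // => i _; rewrite mnm0E.
by rewrite mulmS mnm_evalD IHk mulrS mnm_evalD !mnm_evalU.
Qed.

(** Killing the variables outside [F] leaves the toric monomials supported on
    [F]; [F] the full set gives the toric map itself. *)
Lemma mmap1_restrict (F : {set 'I_N}) m :
  mmap1 (fun v => if v \in F then x_ n K (row v) * yinv_ d K (col v) else 0) m =
  if (mnm_support m \subset F)%SET then 'X_[toric_deg m] else 0.
Proof.
rewrite /mmap1; case: ifPn => [/fintype.subsetP sub | /fintype.subsetPn[v vm vF]].
  rewrite /toric_deg -mprodXnE; apply: eq_bigr => v _.
  have [vm|] := boolP (v \in mnm_support m).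
    by rewrite (sub v vm) mpolyXD.
  by rewrite inE negbK => /eqP->; rewrite !expr0.
rewrite (bigD1 v) //= (negbTE vF) expr0n; move: vm; rewrite inE => /negbTE->.
by rewrite mul0r.
Qed.


(** * Monomials supported on a fine type *)

Definition fine_type_face p : {set 'I_N} :=
  [set v | fine_type A p (row v) (col v)]%SET.

Definition face_map (F : {set 'I_N}) : {mpoly K[N]} -> {mpoly K[d + n]} :=
  mmap (@mpolyC (d + n) K)
    (fun v => if v \in F then x_ n K (row v) * yinv_ d K (col v) else 0).

Lemma face_mapZX (F : {set 'I_N}) (a : K) m :
  face_map F (a *: 'X_[m]) =
  if (mnm_support m \subset F)%SET then a *: 'X_[toric_deg m] else 0.
Proof.
rewrite /face_map mmapZ mmapX mmap1_restrict.
by case: ifP => _; rewrite mul_mpolyC ?scaler0.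
Qed.

Lemma toric_mapX m : toric_map 'X_[K, m] = 'X_[toric_deg m].
Proof.
rewrite /toric_map mmapX.
have := mmap1_restrict [set: 'I_N]%SET m; rewrite finset.subsetT => <-.
by apply: mmap1_eq => v; rewrite inE.
Qed.

Lemma toric_mapE (f : {mpoly K[N]}) :
  toric_map f = \sum_(m <- msupp f) f@_m *: 'X_[toric_deg m].
Proof.
rewrite {1}(mpolyE f) /toric_map raddf_sum; apply: eq_bigr => m _.
by rewrite /= mmapZ mul_mpolyC; congr (_ *: _); exact: toric_mapX.
Qed.

(** The slacks [g] are q_k - (p_i - a_ik), where q_k = max_j (p_j - a_jk) is
    attained since column k has a finite entry.  The vertex function [alpha] is
    p on rows and -q on columns. *)
Lemma fine_type_slack p : tropical_matrix A ->
  exists (g : 'I_N -> R) (alpha : 'I_(d + n) -> R),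
    [/\ forall v, 0 <= g v, forall v, (g v == 0) = (v \in fine_type_face p)
      & forall v, cost v =
          g v + (alpha (lshift n (row v)) + alpha (rshift d (col v)))].
Proof.
move=> [Aninfty Acol].
have max_col k : exists q : R, exists2 i, A i k \is a fin_num &
    q = p i ord0 - fine (A i k) /\
    forall j, A j k \is a fin_num -> p j ord0 - fine (A j k) <= q.
  have [i0 i0P] := Acol k.
  pose P := fun i => A i k \is a fin_num; pose F i := p i ord0 - fine (A i k).
  exists (F [arg max_(i > i0 | P i) F i]%O).
  by case: arg_maxP => // i iP max_i; exists i.
have [q qP] := choice max_col.
exists (fun v => q (col v) - (p (row v) ord0 - cost v)).
exists (fun w => match split w with inl i => p i ord0 | inr k => - q k end).
split=> v.
- have [i _ [_ max_q]] := qP (col v).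
  by rewrite subr_ge0 max_q ?edge_of_fin_num.
- rewrite /fine_type_face inE mxE inE edge_of_fin_num subr_eq0 /=.
  have [i Ai [qi max_q]] := qP (col v).
  apply/eqP/idP => [q_v|]; rewrite inE.
    move=> j; rewrite costE; have [Aj|] := boolP (A j (col v) \is a fin_num).
      by rewrite -[A j _]fineK // -!EFinB lee_fin -q_v max_q.
    have := Aninfty j (col v).
    by case: (A j (col v)) => //= _ _; rewrite addeNy leNye.
  move=> /(_ i); rewrite costE -[A i _]fineK // -!EFinB lee_fin -qi => le_q.
  by apply/eqP; rewrite eq_le le_q max_q ?edge_of_fin_num.
- rewrite (unsplitK (inl _)) (unsplitK (inr _)).
  by rewrite [- (p _ _ - _)]opprB addrA [q _ + (_ - _)]addrA subrK addrC addKr.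
Qed.

(** Fix a toric degree [delta].  On it the weight is [g] plus a constant, so a
    term of degree [delta] that has maximal weight in [f] and is supported on
    the face, where [g] is 0, forces [g] to vanish on all terms of [f] of this
    degree.  All of them then survive in the initial form and under the face
    map, and their coefficients add up to a coefficient of the toric image
    of [f]. *)
Lemma face_map_initial_form p (f : {mpoly K[N]}) : tropical_matrix A ->
  lattice_ideal K A f -> face_map (fine_type_face p) (initial_form f) = 0.
Proof.
move=> /(fine_type_slack p)[g [alpha [g_ge0 g_eq0 cost_g]]].
rewrite /lattice_ideal /= toric_mapE => Lf.
have weightE m : weight m = mnm_eval g m + mnm_eval alpha (toric_deg m).
  rewrite toric_deg_eval -big_split; apply: eq_bigr => v _.
  by rewrite /= -mulrnDl -cost_g.
have g_eval_ge0 m : 0 <= mnm_eval g m.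
  by apply: sumr_ge0 => v _; rewrite mulrn_wge0.
have g_eval_eq0 m :
    (mnm_eval g m == 0) = (mnm_support m \subset fine_type_face p)%SET.
  rewrite psumr_eq0 => [|v _]; last by rewrite mulrn_wge0.
  apply/allP/fintype.subsetP => [g0 v|sub v _]; rewrite /= ?mulrn_eq0.
    have := g0 v (mem_index_enum v); rewrite /= mulrn_eq0 g_eq0.
    by rewrite [v \in mnm_support m]inE; case: (m v == 0%N).
  by case: eqP => //= /eqP mv; rewrite g_eq0; apply: sub; rewrite inE.
set top := fun m => all (fun m' : 'X_{1..N} => weight m' <= weight m) (msupp f).
have -> : face_map (fine_type_face p) (initial_form f) =
    \sum_(m <- msupp f | top m && (mnm_support m \subset fine_type_face p)%SET)
       f@_m *: 'X_[toric_deg m].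
  rewrite /initial_form /face_map raddf_sum big_mkcondr /=.
  by apply: eq_bigr => m _; exact: face_mapZX.
apply/mpolyP => delta; rewrite mcoeff0.
have [[m0 [m0f top0 face0 deg0]]|none] := pselect (exists m0,
    [/\ m0 \in msupp f, top m0, (mnm_support m0 \subset fine_type_face p)%SET
      & toric_deg m0 = delta]); last first.
  rewrite raddf_sum big_seq_cond big1 //= => m /andP[mf /andP[topm facem]].
  rewrite mcoeffZ mcoeffX; case: eqP => [degm|_]; last by rewrite mulr0.
  by case: none; exists m.
transitivity (\sum_(m <- msupp f) f@_m *: 'X_[K, toric_deg m])@_delta;
  last by rewrite Lf mcoeff0.
rewrite !raddf_sum [LHS]big_mkcond /= [LHS]big_seq [RHS]big_seq.
apply: eq_bigr => m mf; case: ifPn => //.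
rewrite mcoeffZ mcoeffX; case: eqP => [degm|]; last by rewrite mulr0.
have m_m0 : weight m <= weight m0 := allP top0 m mf.
have w_m0 : weight m0 = mnm_eval alpha delta.
  move: face0; rewrite weightE deg0 -g_eval_eq0 => /eqP->.
  by rewrite add0r.
have gm0 : mnm_eval g m = 0.
  apply/eqP; rewrite eq_le g_eval_ge0 andbT.
  by move: m_m0; rewrite weightE degm w_m0 gerDr.
rewrite -g_eval_eq0 gm0 eqxx andbT => /negP[].
apply/allP => m' m'f; apply: le_trans (allP top0 m' m'f) _.
by rewrite w_m0 weightE gm0 add0r degm.
Qed.

Lemma initial_ideal_face p m : tropical_matrix A ->
  initial_ideal A (lattice_ideal K A) 'X_[m] ->
  ~~ (mnm_support m \subset fine_type_face p)%SET.
Proof.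
move=> Atrop in_m; apply/negP => face_m.
have : face_map (fine_type_face p) 'X_[m] = 0.
  move: in_m; apply: (ideal_gen_min (I := [set f | face_map _ f = 0])).
    rewrite /face_map; split=> /= [|f g f0 g0|f g g0].
    - exact: raddf0.
    - by rewrite raddfD /= f0 g0 addr0.
    - by rewrite rmorphM /= g0 mulr0.
  by move=> _ [f Lf <-]; exact: face_map_initial_form.
rewrite -['X_[m]]scale1r face_mapZX face_m scale1r => /mpolyP/(_ (toric_deg m)).
by move/eqP; rewrite mcoeffX mcoeff0 eqxx oner_eq0.
Qed.

(** * Negative cycles give binomials *)

Local Notation V := ('I_d + 'I_n)%type.

Definition arc_out v : V * V := (inl (row v), inr (col v)).
Definition arc_in v : V * V := (inr (col v), inl (row v)).

(** The potentials for [arc_cost] on this graph are the solutions (p, q) of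
    p_j - a_jk <= q_k for all edges and q_k <= p_i - a_ik for edges in [tau]. *)
Definition constraint_arc (tau : {set 'I_N}) : rel V := fun x y =>
  [exists v, arc_out v == (x, y)] || [exists v in tau, arc_in v == (x, y)].

(** Each sum has at most one term: the cost is a_jk on the arc leaving row j
    for column k, and -a_ik on the arc from column k into row i. *)
Definition arc_cost (a : V * V) : R :=
  \sum_(v | arc_out v == a) cost v - \sum_(v | arc_in v == a) cost v.

Lemma arc_out_inj : injective arc_out.
Proof.
move=> v w [rvw cvw]; apply: edge_of_inj.
by rewrite [LHS]surjective_pairing rvw cvw -surjective_pairing.
Qed.

Lemma arc_in_inj : injective arc_in.
Proof.
move=> v w [cvw rvw]; apply: edge_of_inj.
by rewrite [LHS]surjective_pairing rvw cvw -surjective_pairing.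
Qed.

Lemma arc_cost_out v : arc_cost (arc_out v) = cost v.
Proof.
rewrite /arc_cost (big_pred1 v) => [|w]; last first.
  by rewrite /= (inj_eq arc_out_inj).
by rewrite big_pred0 ?subr0.
Qed.

Lemma arc_cost_in v : arc_cost (arc_in v) = - cost v.
Proof.
rewrite /arc_cost big_pred0 // (big_pred1 v) ?sub0r // => w.
by rewrite /= (inj_eq arc_in_inj).
Qed.

(** The product of the edges whose arc, in the direction chosen by [h], is in
    the list [r], with multiplicity. *)
Definition arc_mnm (h : 'I_N -> V * V) (r : seq (V * V)) : 'X_{1..N} :=
  [multinom count_mem (h v) r | v < N].

Lemma arc_mnm_eval (h : 'I_N -> V * V) (g : 'I_N -> R) r :
  mnm_eval g (arc_mnm h r) = \sum_(a <- r) \sum_(v | h v == a) g v.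
Proof.
rewrite (exchange_big_dep predT) //=; apply: eq_bigr => v _.
rewrite mnmE; elim: r => [|a r IHr]; first by rewrite big_nil.
rewrite big_cons /= -IHr eq_sym mulrnDr.
by case: eqP => _; rewrite ?mulr1n // mulr0n add0r.
Qed.

Lemma arc_mnm_toric_deg (h : 'I_N -> V * V) r :
  toric_deg (arc_mnm h r) = (\sum_(a <- r) \sum_(v | h v == a) edge_deg v)%MM.
Proof.
rewrite (exchange_big_dep predT) //=; apply: eq_bigr => v _.
rewrite mnmE; elim: r => [|a r IHr]; first by rewrite big_nil mulm0n.
rewrite big_cons /= -IHr eq_sym.
by case: eqP => _; rewrite ?mulmS.
Qed.

Definition row_deg (x : V) : 'X_{1..d + n} :=
  if x is inl i then U_(lshift n i)%MM else 0%MM.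
Definition col_deg (x : V) : 'X_{1..d + n} :=
  if x is inr k then U_(rshift d k)%MM else 0%MM.

(** Every arc of the constraint graph that leaves a row or enters a column is
    an [arc_out], so the degree of the underlying edge can be charged to the
    ends of the arc separately; likewise for [arc_in]. *)
Lemma arc_out_deg tau x y : constraint_arc tau x y ->
  (\sum_(v | arc_out v == (x, y)) edge_deg v = row_deg x + col_deg y)%MM.
Proof.
case/orP => /existsP[v].
  move=> /eqP[<- <-]; rewrite (big_pred1 v) //= => w.
  by rewrite -[(inl _, _)]/(arc_out v) (inj_eq arc_out_inj).
move=> /andP[_ /eqP[<- <-]]; rewrite big_pred0 /= ?mulm0n //.
by rewrite addm0.
Qed.

Lemma arc_in_deg tau x y : constraint_arc tau x y ->
  (\sum_(v | arc_in v == (x, y)) edge_deg v = col_deg x + row_deg y)%MM.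
Proof.
case/orP => /existsP[v].
  by move=> /eqP[<- <-]; rewrite big_pred0 //= addm0.
move=> /andP[_ /eqP[<- <-]]; rewrite (big_pred1 v) /= 1?addmC // => w.
by rewrite -[(inr _, _)]/(arc_in v) (inj_eq arc_in_inj).
Qed.

Lemma path_arcs (e : rel V) x s a : path e x s -> a \in arcs x s -> e a.1 a.2.
Proof.
elim: s x => [|y s IHs] x //= /andP[xy ys]; rewrite inE => /orP[/eqP->//|].
exact: IHs.
Qed.

Lemma unzip2_arcs (x : V) s : unzip2 (arcs x s) = s.
Proof. by rewrite unzip2_zip /=. Qed.

(** The sources and the targets of the arcs of a closed walk are the same
    vertices up to order. *)
Lemma sum_closed_walk (g h : V -> 'X_{1..d + n}) x s :
  (\sum_(a <- arcs x (rcons s x)) (g a.1 + h a.2) =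
   \sum_(y <- x :: s) (g y + h y))%MM.
Proof.
have unzip1_arcs t y : unzip1 (arcs y t) = belast y t.
  by elim: t y => //= z t IHt y; rewrite -IHt.
rewrite [LHS]big_split [RHS]big_split /= -(big_map fst xpredT g).
rewrite -(big_map snd xpredT h).
rewrite [map _ _]unzip1_arcs [map snd _]unzip2_arcs belast_rcons.
by congr (_ + _)%MM; apply: perm_big; rewrite perm_rcons.
Qed.

(** Each row of the cycle contributes to the edges traversed outwards as a
    source and to those traversed inwards as a target, and conversely for
    columns. *)
Lemma cycle_toric_deg tau x s : path (constraint_arc tau) x (rcons s x) ->
  toric_deg (arc_mnm arc_in (arcs x (rcons s x))) =
  toric_deg (arc_mnm arc_out (arcs x (rcons s x))).
Proof.
move=> xs; rewrite !arc_mnm_toric_deg.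
rewrite (eq_big_seq (fun a => col_deg a.1 + row_deg a.2)%MM); last first.
  by move=> [y z] /(path_arcs xs) /arc_in_deg.
rewrite [RHS](eq_big_seq (fun a => row_deg a.1 + col_deg a.2)%MM); last first.
  by move=> [y z] /(path_arcs xs) /arc_out_deg.
by rewrite !sum_closed_walk; apply: eq_bigr => y _; rewrite addmC.
Qed.

Lemma cycle_cost x s :
  walk_cost arc_cost x s =
  weight (arc_mnm arc_out (arcs x s)) - weight (arc_mnm arc_in (arcs x s)).
Proof.
rewrite [weight _]arc_mnm_eval [X in _ - X]arc_mnm_eval.
by rewrite -sumrN -big_split.
Qed.

(** The binomial ['X_[u] - 'X_[v]] is in the lattice ideal and its initial form
    is its first term. *)
Lemma binomial_initial_ideal (u v : 'X_{1..N}) :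
  toric_deg u = toric_deg v -> weight v < weight u ->
  initial_ideal A (lattice_ideal K A) 'X_[u].
Proof.
move=> deg_uv lt_vu; apply: ideal_gen_sub.
exists ('X_[u] - 'X_[v]).
  by rewrite /lattice_ideal /= /toric_map mmapB -!/(toric_map _) !toric_mapX
             deg_uv subrr.
have neq_uv : u != v by apply: contraTneq lt_vu => ->; rewrite ltxx.
have supp_uv : perm_eq (msupp ('X_[K, u] - 'X_[v])) [:: u; v].
  apply: uniq_perm => [||m]; first exact: msupp_uniq.
    by rewrite /= inE neq_uv.
  rewrite -[LHS]negbK -mcoeff_eq0 mcoeffB !mcoeffX !inE ![m == _]eq_sym.
  have [<-|_] := eqVneq u m.
    by rewrite [v == u]eq_sym (negbTE neq_uv) subr0 oner_eq0.
  by have [_|_] := eqVneq v m; rewrite sub0r oppr_eq0 ?oner_eq0 ?eqxx.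
rewrite /initial_form (perm_big _ supp_uv) !big_cons big_nil.
rewrite !(perm_all _ supp_uv) /= !lexx (ltW lt_vu) leNgt lt_vu /=.
rewrite mcoeffB !mcoeffX eqxx eq_sym (negbTE neq_uv) subr0 scale1r addr0 //.
Qed.

Lemma non_face_initial_ideal m : tropical_matrix A ->
  (forall p, ~~ (mnm_support m \subset fine_type_face p)%SET) ->
  initial_ideal A (lattice_ideal K A) 'X_[m].
Proof.
move=> [Aninfty _] nface; apply: contrapT => nin.
have : no_negative_cycle (constraint_arc (mnm_support m)) arc_cost.
  move=> x s uxs xs; rewrite leNgt; apply/negP; rewrite cycle_cost subr_lt0.
  move=> /(binomial_initial_ideal (cycle_toric_deg xs)) in_u; apply: nin.
  apply: ideal_mulX in_u _; first exact: ideal_gen_ideal.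
  apply/mnm_lepP => v; rewrite mnmE count_uniq_mem; last first.
    by apply: (map_uniq (f := snd)); rewrite [map _ _]unzip2_arcs rcons_uniq.
  case: (boolP (_ \in _)) => // /(path_arcs xs) /orP[/existsP[w]//|].
  by move=> /existsP[w /andP[+ /eqP/arc_in_inj <-]]; rewrite inE lt0n.
move=> /potential_exists[phi phiP].
pose p : 'cV[R]_d := \col_i phi (inl i).
apply: (negP (nface p)); apply/fintype.subsetP => v vm.
rewrite inE mxE inE edge_of_fin_num /=; apply/mem_set => j.
rewrite !mxE costE.
have [Aj|] := boolP (A j (col v) \is a fin_num); last first.
  have := Aninfty j (col v).
  by case: (A j (col v)) => //= _ _; rewrite addeNy leNye.
have [w w_jk] := edge_of_surj Aj.
have cost_w : A j (col v) = (cost w)%:E by rewrite -costE w_jk.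
have out_arc : constraint_arc (mnm_support m) (inl j) (inr (col v)).
  by apply/orP; left; apply/existsP; exists w; rewrite /arc_out w_jk.
have in_arc : constraint_arc (mnm_support m) (inr (col v)) (inl (row v)).
  by apply/orP; right; apply/existsP; exists v; rewrite vm /=.
have := le_trans (phiP _ _ out_arc) (lerD (lexx _) (phiP _ _ in_arc)).
rewrite -[(inr _, _)]/(arc_in v) arc_cost_in.
have -> : (inl j, inr (col v)) = arc_out w by rewrite /arc_out w_jk.
by rewrite arc_cost_out cost_w -!EFinB lee_fin lerBlDl [- cost v + _]addrC.
Qed.

End Toric.

Theorem theoremC (R : realType) (K : fieldType) (d n : nat)
    (A : 'M[\bar R]_(d, n)) (hA : tropical_matrix A) :
  exists M : set {mpoly K[nvars A]},
    is_largest_monomial_subideal (initial_ideal A (lattice_ideal K A)) M /\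
    is_alexander_dual M (cotype_ideal K A).
Proof.
exists (ideal_gen [set 'X_[K, m] | m in
  [set m | forall p, ~~ (mnm_support m \subset fine_type_face A p)%SET]]).
split.
  split.
  - by exists [set m |
      forall p, ~~ (mnm_support m \subset fine_type_face A p)%SET].
  - apply: ideal_gen_min; first exact: ideal_gen_ideal.
    by move=> _ [m nface <-]; exact: non_face_initial_ideal.
  - move=> _ [G ->] sub; apply: ideal_gen_mono => _ [m Gm <-].
    exists m => //= p; apply: (initial_ideal_face (K := K)) => //.
    by apply: sub; apply: ideal_gen_sub; exists m.
have -> : cotype_ideal K A =
    ideal_gen (range (fun p => \prod_(v in (~: fine_type_face A p)%SET) 'X_v)).
  congr (ideal_gen (S := {mpoly K[nvars A]}) _); apply: eq_imagel => p _.
  apply: eq_bigl => v.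
  by rewrite !inE mxE inE edge_of_fin_num.
exact: face_ideal_alexander_dual.
Qed.
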